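(* Let $k\ge 3$ be an integer. For $p=p(n)\in[0,1]$, let $H_{n,p;k}$ denote the random $k$-uniform hypergraph on vertex set $[n]$ in which each of the $\binom{n}{k}$ possible $k$-element subsets is included as an edge independently with probability $p$. If $p n^{k-1}/\log n\to\infty$ as $n\to\infty$, then $$\lim_{\substack{n\to\infty\\ 2(k-1)\mid n}}\Pr\big(H_{n,p;k}\text{ contains a loose Hamilton cycle}\big)=1.$$
   Context: A $k$-uniform hypergraph is a pair $(V,E)$ with $E\subseteq\binom{V}{k}$. A $k$-uniform hypergraph $(V,E)$ contains a loose Hamilton cycle if there is a cyclic ordering of all of $V$ and a set of edges of the hypergraph, each consisting of $k$ consecutive vertices in this ordering, such that consecutive edges intersect in exactly one vertex and every vertex lies in some of these edges (i.e. a cycle through all $|V|$ vertices with the minimum possible number of edges). *)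

(* Defs.v *)
From mathcomp Require Import all_boot all_order all_algebra.

Set Implicit Arguments.
Unset Strict Implicit.
Unset Printing Implicit Defensive.

Import GRing.Theory.

Definition ksubsets (n k : nat) : {set {set 'I_n}} :=
  [set e : {set 'I_n} | #|e| == k].

(* The vertices listed by [v], read cyclically, from position [i] on: [k] of
   them when [k <= n], and all of them when [n <= k]. *)
Definition cyclic_interval (n : nat) (v : n.-tuple 'I_n) (k : nat) (i : 'I_n) :
    {set 'I_n} :=
  [set x in take k (rot i v)].

(* [A] is the set of the initial positions of the edges of the cycle: as
   [enum A] is increasing, [path.cycle] relates each edge to the one that comes
   next in the cyclic ordering [v], and the last edge to the first. *)
Definition is_loose_hamilton_cycle (n k : nat) (H : {set {set 'I_n}})
    (v : n.-tuple 'I_n) (A : {set 'I_n}) : bool :=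
  [&& uniq v,
      [forall i in A, cyclic_interval v k i \in H],
      path.cycle (fun e f : {set 'I_n} => #|e :&: f| == 1)
                 [seq cyclic_interval v k i | i <- enum A]
    & [forall x, exists i in A, x \in cyclic_interval v k i]].

Definition has_loose_hamilton_cycle (n k : nat) (H : {set {set 'I_n}}) : bool :=
  [exists v : n.-tuple 'I_n, exists A : {set 'I_n},
     is_loose_hamilton_cycle k H v A].

Local Open Scope ring_scope.

(* Independence of the edges: the probability that the random hypergraph equals
   [H] is the product, over all possible edges [e], of the probability that [e]
   is present or absent as in [H]. *)
Definition hypergraph_weight (R : comNzRingType) (n k : nat) (p : R)
    (H : {set {set 'I_n}}) : R :=
  \prod_(e in ksubsets n k) (if e \in H then p else 1 - p).

Definition hypergraph_Pr (R : comNzRingType) (n k : nat) (p : R)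
    (Q : pred {set {set 'I_n}}) : R :=
  \sum_(H : {set {set 'I_n}} | (H \subset ksubsets n k) && Q H)
    hypergraph_weight k p H.

(* Main.v *)
(* The uniform measure on the loose Hamilton cycles given by the permutations of
   the vertices is spread: a fixed set of [t] edges lies in a proportion at most
   [(C / n ^ (k - 1)) ^ t] of these cycles. For a spread family of sets of size at
   most [r], expose the random set [W] in about [log2 r] independent rounds. After
   a round, replace each member by its fragment: the smallest [F j :\: W] with [F j]
   inside the union of [W] and this member. The union bound of Park and Pham shows
   that few fragments have more than [r / 2] elements; the others form a family
   which is as spread as the first one, and whose sets are half as large. When the
   sizes reach 0, some member is covered by the exposed set. The number of rounds
   accounts for the factor [log n] in the threshold. *)

Require Import Defs.
From mathcomp Require Import all_boot all_order all_algebra.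
From mathcomp Require Import perm ring lra zify.

Set Implicit Arguments.
Unset Strict Implicit.
Unset Printing Implicit Defensive.

Import Order.TTheory GRing.Theory Num.Theory.

(** * Counting the cycles through given edges *)

Section ForcedPaths.
Variables (T : finType) (r : rel T).

(** An explicit enumeration, so that the branching can be bounded one step at a time; [P] is the
    constraint that the previous element puts on the next one. *)
Fixpoint paths_from (m : nat) (P : pred T) (A : {set T}) : seq (seq T) :=
  if m is m'.+1 then
    flatten [seq [seq y :: s | s <- paths_from m' (r y) (A :\ y)]
            | y <- enum A & P y]
  else [:: [::]].

Lemma mem_paths_from s (P : pred T) (A : {set T}) :
    uniq s -> {subset s <= A} -> all P (take 1 s) -> sorted r s ->
  s \in paths_from (size s) P A.
Proof.
elim: s P A => [|y s IHs] P A //= /andP[ys us] sA; rewrite take0 andbT => Py rys.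
apply/flatten_mapP; exists y; first by rewrite mem_filter Py mem_enum sA ?mem_head.
apply: map_f; apply: IHs => //.
- move=> z zs; rewrite !inE sA ?andbT; last by rewrite inE zs orbT.
  by apply: contraNneq ys => <-.
- by move: rys; case: (s) => //= z s' /andP[-> _]; rewrite take0.
- exact: path_sorted rys.
Qed.

Definition forcing (V : {set T}) (P : pred T) :=
  (exists y0, forall y, P y -> y = y0) \/ (forall y, P y -> y \notin V).

(* Each step is either forced or lands outside [V], so that only the elements
   of [A :\: V] are ever chosen freely. *)
Lemma size_paths_from (V : {set T}) : (forall x, forcing V (r x)) ->
  forall m (P : pred T) (A : {set T}), #|A| = m -> forcing V P ->
  (size (paths_from m P A) <= #|A :\: V|`!)%N.
Proof.
move=> rV; elim=> [|m IHm] P A Am PV /=; first by rewrite fact_gt0.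
have {}IHm y : y \in A -> (size (paths_from m (r y) (A :\ y)) <= #|(A :\ y) :\: V|`!)%N.
  by move=> yA; apply: IHm => //; apply/eqP; rewrite -eqSS -Am (cardsD1 y A) yA.
rewrite size_flatten /shape -map_comp sumnE big_map big_filter /=.
case: PV => [[y0 Py0]|PV].
  rewrite big_enum_cond /=.
  apply: (@leq_trans (\sum_(y in A | y == y0) #|A :\: V|`!)).
    rewrite big_mkcond [leqRHS]big_mkcond; apply: leq_sum => y _.
    case: (boolP (y \in A)) => //= yA; case: (boolP (P y)) => // Py.
    rewrite (introT eqP (Py0 y Py)) size_map; apply: leq_trans (IHm y yA) _.
    by apply: leq_fact; apply: subset_leq_card; apply: setSD; apply: subD1set.
  rewrite sum_nat_const -[leqRHS]mul1n leq_mul2r; apply/orP; right.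
  rewrite -[leqRHS](card1 y0); apply: subset_leq_card; apply/subsetP => y.
  by rewrite inE => /andP[].
(* Free step: each admissible [y] lies in [A :\: V] and is removed from it, so that [c] choices with
   at most [(c - 1)!] continuations each give at most [c!]. *)
rewrite big_enum_cond /=.
apply: (@leq_trans (\sum_(y in A :\: V) (#|A :\: V|.-1)`!)).
  rewrite big_mkcond [leqRHS]big_mkcond; apply: leq_sum => y _.
  case: (boolP (y \in A)) => //= yA; case: (boolP (P y)) => // /PV yV.
  rewrite inE yA yV size_map; apply: leq_trans (IHm y yA) _.
  have -> : A :\ y :\: V = (A :\: V) :\ y.
    by apply/setP => z; rewrite !inE andbCA.
  by rewrite (cardsD1 y (A :\: V)) inE yA yV.
rewrite sum_nat_const.
by case: #|A :\: V| => [|c] //=; rewrite factS.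
Qed.

End ForcedPaths.

(** * Blocks of positions and the spread of loose cycles *)

Section CyclicEdges.
Variables (n d : nat).
Implicit Types (s : {perm 'I_n}) (T : {set {set 'I_n}}).

(** Here [d] is k - 1. When [d] divides [n], block [j] runs from position jd to position (j+1)d; the
    end is reduced modulo [n] so that the last block closes up at 0. *)
Definition block_positions (j : nat) : {set 'I_n} :=
  [set i : 'I_n | (i %/ d == j) || (i == (j.+1 * d) %% n :> nat)].

Definition cycle_edge s (j : nat) : {set 'I_n} := s @: block_positions j.

Definition cycle_edges s : {set {set 'I_n}} :=
  [set cycle_edge s j | j : 'I_(n %/ d)].

(** Records which vertex follows which inside the edges of [T]. It depends on [s] but takes few
    values, since the pairs lie in the squares of the edges of [T]. *)
Definition consecutive_pairs s T : {set 'I_n * 'I_n} :=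
  [set (s i, s (ordS i)) | i in [set i : 'I_n | cycle_edge s (i %/ d) \in T]].

Definition targets (D : {set 'I_n * 'I_n}) : {set 'I_n} := [set p.2 | p in D].

(** A pair of [D] starting at [x] forces [y]; if there is none, [y] cannot be a target. This
    dichotomy is the one required by [forcing]. *)
Definition compatible (D : {set 'I_n * 'I_n}) : rel 'I_n :=
  fun x y => [forall p in D, (p.1 == x) == (p.2 == y)].

Lemma compatible_forcing D x : forcing (targets D) (compatible D x).
Proof.
case: (pickP [pred p in D | p.1 == x]) => [p /= /andP[pD px]|noP].
  left; exists p.2 => y /forallP/(_ p); rewrite pD px /=.
  by move/eqP/esym/eqP.
right=> y /forallP cxy; apply/imsetP => -[p pD yp].
have := cxy p; rewrite pD yp eqxx /= => /eqP px.
by have := noP p; rewrite /= pD px.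
Qed.

Hypotheses (d_gt0 : (0 < d)%N) (dvd_dn : (d %| n)%N).

Lemma ordS_block_positions (i : 'I_n) : ordS i \in block_positions (i %/ d).
Proof.
rewrite inE /=; have n0 : (0 < n)%N by apply: leq_ltn_trans (ltn_ord i).
have [dSi|dSi] := boolP (d %| i.+1)%N.
  apply/orP; right; apply/eqP; congr (_ %% _)%N.
  rewrite -{1}(divnK dSi); congr (_ * _)%N.
  by rewrite divnS ?dSi.
have lt_Si : (i.+1 < n)%N.
  by rewrite ltn_neqAle ltn_ord andbT; apply: contraNneq dSi => ->.
by rewrite modn_small // divnS // (negbTE dSi) eqxx.
Qed.

Lemma block_positions_divn (i : 'I_n) : i \in block_positions (i %/ d).
Proof. by rewrite inE eqxx. Qed.

Lemma card_block_positions_le j : (#|block_positions j| <= d.+1)%N.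
Proof.
have -> : block_positions j =
    [set i : 'I_n | i %/ d == j] :|: [set i : 'I_n | i == (j.+1 * d) %% n :> nat].
  by apply/setP => i; rewrite !inE.
rewrite -(addn1 d); apply: leq_trans (leq_card_setU _ _) _; apply: leq_add.
  pose f (i : 'I_n) := Ordinal (ltn_pmod i d_gt0).
  rewrite -[leqRHS]card_ord -(card_in_imset (f := f)) ?max_card // => a b.
  rewrite !inE => /eqP aj /eqP bj /(congr1 val) /= ab; apply/val_inj => /=.
  by rewrite (divn_eq a d) (divn_eq b d) aj bj ab.
rewrite leqNgt; apply/negP => /card_gt1P[a [b []]].
by rewrite !inE => /eqP aE /eqP bE /negP; apply; apply/eqP/val_inj; rewrite /= aE.
Qed.

Lemma consecutive_pairs_sub s T :
  consecutive_pairs s T \subset \bigcup_(e in T) finset.setX e e.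
Proof.
apply/subsetP => p /imsetP[i]; rewrite inE => iT ->.
apply/bigcupP; exists (cycle_edge s (i %/ d)) => //.
by rewrite inE /= !imset_f ?ordS_block_positions ?block_positions_divn.
Qed.

(** Distinct positions have distinct successors, so it is enough to count positions; each edge of
    [T] accounts for the [d] positions from jd to jd + d - 1 of its block. *)
Lemma card_targets s T : T \subset cycle_edges s ->
  (#|T| * d <= #|targets (consecutive_pairs s T)|)%N.
Proof.
move=> Ts; rewrite /targets /consecutive_pairs -imset_comp card_imset; last first.
  by move=> i j /= /perm_inj/ordS_inj.
rewrite -[leqRHS]sum1_card (partition_big (fun i : 'I_n => cycle_edge s (i %/ d)) (mem T)) /=;
  last by move=> i; rewrite inE.
rewrite -sum_nat_const; apply: leq_sum => e eT.
have /imsetP[j _ ej] := subsetP Ts e eT.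
have jd_lt (a : 'I_d) : (j * d + a < n)%N.
  rewrite -[ltnRHS](divnK dvd_dn); apply: (@leq_trans (j.+1 * d)).
    by rewrite mulSnr ltn_add2l.
  by rewrite leq_mul2r ltn_ord orbT.
pose f (a : 'I_d) := Ordinal (jd_lt a).
rewrite sum1_card -[leqLHS]card_ord -(card_codom (f := f)); last first.
  by move=> a b /(congr1 val) /= /addnI /val_inj.
apply: subset_leq_card; apply/subsetP => i /codomP[a ->].
by rewrite unfold_in /= inE /= divnMDl // (divn_small (ltn_ord a)) addn0 -ej eT eqxx.
Qed.

Lemma compatible_ordS s T (i : 'I_n) :
  compatible (consecutive_pairs s T) (s i) (s (ordS i)).
Proof.
apply/forallP => p; apply/implyP => /imsetP[i' _ ->] /=.
by rewrite !(inj_eq perm_inj) (inj_eq (@ordS_inj n)).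
Qed.

(* A permutation [s] is read as the list of its values. Given the consecutive
   pairs inside edges of [T], and [s ord0] when it lies in an edge of [T], it is a
   path in which every target is forced. *)
Lemma card_spread_perms T : (0 < n)%N ->
  (#|[set s | T \subset cycle_edges s]| <=
   2 ^ (#|T| * (d.+1 * d.+2)) * (n - #|T| * d)`!)%N.
Proof.
move=> n_gt0.
pose o0 : 'I_n := Ordinal n_gt0.
pose B := [set s | T \subset cycle_edges s].
pose code s := (consecutive_pairs s T, if s o0 \in cover T then Some (s o0) else None).
have fiber c : c \in code @: B -> (#|[set s in B | code s == c]| <= (n - #|T| * d)`!)%N.
  case/imsetP => s0; rewrite inE => Ts0 ->.
  pose D := consecutive_pairs s0 T; pose V := targets D.
  (* The start is forced too: it is the vertex kept in the code, or else it lies in no edge of [T],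
     hence is not a target, as [VT] shows. *)
  pose P : pred 'I_n := if (code s0).2 is Some x then pred1 x else [pred y | y \notin V].
  have VT : V \subset cover T.
    apply/subsetP => _ /imsetP[p /(subsetP (consecutive_pairs_sub _ _)) pU ->].
    case/bigcupP: pU => e eT; rewrite inE => /andP[_ pe].
    by apply/bigcupP; exists e.
  have PV : forcing V P.
    rewrite /P; case: (code s0).2 => [x|]; first by left; exists x => y /eqP.
    by right.
  pose f s : seq 'I_n := [seq s i | i <- enum 'I_n].
  have fE s j : (j < n)%N -> nth o0 (f s) j = s (nth o0 (enum 'I_n) j).
    by move=> lt_j; rewrite (nth_map o0) ?size_enum_ord.
  have f_inj : injective f.
    move=> s s' ss'; apply/permP => i.
    have /(congr1 (fun l => nth o0 l i)) := ss'.
    by rewrite /= !fE // !nth_ord_enum.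
  have cardT : #|[set: 'I_n]| = n by rewrite cardsT card_ord.
  apply: leq_trans (leq_trans (size_paths_from (compatible_forcing D) cardT PV) _).
    rewrite cardE -(size_map f); apply: uniq_leq_size.
      by rewrite map_inj_uniq // enum_uniq.
    move=> l /mapP[s]; rewrite mem_enum inE => /andP[sB /eqP ss0] ->.
    have fn : size (f s) = n by rewrite size_map size_enum_ord.
    rewrite -[X in paths_from _ X]fn; apply: mem_paths_from.
    - by rewrite map_inj_uniq ?enum_uniq //; apply: perm_inj.
    - by move=> x; rewrite inE.
    - rewrite (_ : take 1 (f s) = [:: s o0]); last first.
        rewrite /f; case E: (enum 'I_n) => [|x l'].
          by have := n_gt0; rewrite -{1}(size_enum_ord n) E.
        rewrite /= take0; congr [:: s _]; apply/val_inj => /=.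
        by have := nth_enum_ord o0 n_gt0; rewrite E.
      rewrite /= andbT /P -ss0 /=; case: ifP => [_|sT] /=; first exact: eqxx.
      by apply: contraFN sT => /(subsetP VT).
    - apply/(sortedP o0) => i; rewrite fn => lt_Si.
      have lt_i : (i < n)%N by apply: ltnW.
      rewrite !fE //; have -> : nth o0 (enum 'I_n) i.+1 = ordS (nth o0 (enum 'I_n) i).
        by apply/val_inj; rewrite /= !nth_enum_ord // modn_small.
      by rewrite /D; case: ss0 => <- _; apply: compatible_ordS.
  (* The free choices are among the non-targets, of which at most n - |T|d remain. *)
  apply: leq_fact; rewrite setTD cardsCs setCK card_ord leq_sub2l //.
  exact: card_targets.
have [B0|[s0]] := set_0Vmem B; first by rewrite -/B B0 cards0.
rewrite inE => Ts0.
have Te e : e \in T -> (#|e| <= d.+1)%N.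
  move=> /(subsetP Ts0) /imsetP[j _ ->].
  by apply: leq_trans (leq_imset_card _ _) (card_block_positions_le _).
rewrite -sum1_card (partition_big_imset code) /=.
apply: (@leq_trans (\sum_(c in code @: B) (n - #|T| * d)`!)).
  apply: leq_sum => c /fiber; apply: leq_trans.
  by rewrite sum1_card; apply: subset_leq_card; apply/subsetP => s; rewrite [X in is_true X -> _]unfold_in /= !inE.
rewrite sum_nat_const leq_mul2r; apply/orP; right.
pose U := \bigcup_(e in T) finset.setX e e.
apply: (@leq_trans #|finset.setX (powerset U) (None |: [set Some x | x in cover T])|).
  apply: subset_leq_card; apply/subsetP => _ /imsetP[s _ ->].
  rewrite !inE consecutive_pairs_sub /=; case: ifP => [sT|_] //=.
  by rewrite imset_f.
rewrite cardsX card_powerset.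
have cT : (#|cover T| <= #|T| * d.+1)%N.
  rewrite -sum_nat_const; apply: leq_trans (leq_card_cover T) _.
  exact: leq_sum.
have cU : (#|U| <= #|T| * (d.+1 * d.+1))%N.
  rewrite /U -cover_imset; apply: leq_trans (leq_card_cover _) _.
  apply: (@leq_trans (\sum_(E in [set finset.setX e e | e in T]) d.+1 * d.+1)).
    by apply: leq_sum => _ /imsetP[e eT ->]; rewrite cardsX leq_mul ?Te.
  by rewrite sum_nat_const leq_mul2r leq_imset_card orbT.
(* The exponent splits as |T|(d+1)^2 + |T|(d+1): the first part counts the sets of consecutive
   pairs, and the second exceeds the |T|(d+1) + 1 options for the first vertex. *)
rewrite [(d.+1 * _)%N]mulnS mulnDr addnC expnD; apply: leq_mul.
  by rewrite leq_exp2l.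
apply: leq_trans (_ : (#|T| * d.+1).+1 <= _)%N; last exact: ltn_expl.
rewrite cardsU1 -(add1n (_ * _)); apply: leq_add; first by case: (_ \notin _).
exact: leq_trans (leq_imset_card _ _) cT.
Qed.

End CyclicEdges.

(** * Loose Hamilton cycles from permutations *)

Lemma filter_dvdn_iota d l : (0 < d)%N ->
  [seq i <- iota 0 (l * d) | d %| i] = [seq j * d | j <- iota 0 l].
Proof.
move=> d_gt0; elim: l => [|l IHl] //; rewrite mulSnr iotaD filter_cat IHl.
rewrite -(addn1 l) iotaD map_cat; congr (_ ++ _); rewrite !add0n /=.
case: d d_gt0 {IHl} => // d _; rewrite /= dvdn_mull //; congr (_ :: _).
rewrite (eq_in_filter (a2 := pred0)) ?filter_pred0 // => i.
rewrite mem_iota => /andP[li il]; apply/negbTE/dvdnP => -[q iq].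
by move: li il; rewrite iq addSnnS -mulSnr !ltn_pmul2r // => lq; rewrite ltnS leqNgt lq.
Qed.

Lemma cycle_iota (e : rel nat) l : (forall j, (j < l)%N -> e j (j.+1 %% l)) ->
  path.cycle e (iota 0 l).
Proof.
case: l => // l el; rewrite /= rcons_path.
have -> : last 0 (iota 1 l) = l by rewrite (last_nth 0) size_iota -[0 :: _]/(iota 0 l.+1) nth_iota.
apply/andP; split; last by have := el l (ltnSn l); rewrite modnn.
have : forall j, (j < 0 + l)%N -> e j j.+1.
  move=> j jl; have := el j (leqW jl); rewrite modn_small // ltnS.
elim: l 0 {el} => //= l IHl i ei; rewrite ei ?addnS ?ltnS ?leq_addr //=.
by apply: IHl => j; rewrite addSnnS; apply: ei.
Qed.

Section LooseCycle.
Variables (n d : nat) (s : {perm 'I_n}).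
Hypotheses (d_gt0 : (0 < d)%N) (dvd_dn : (d %| n)%N) (n_ge3d : (3 <= n %/ d)%N).

Let v : n.-tuple 'I_n := [tuple s i | i < n].

Lemma lt_block j a : (j < n %/ d)%N -> (a < d)%N -> (j * d + a < n)%N.
Proof.
move=> jn ad; rewrite -[ltnRHS](divnK dvd_dn); apply: (@leq_trans (j.+1 * d)).
  by rewrite mulSnr ltn_add2l.
by rewrite leq_mul2r jn orbT.
Qed.

Lemma block_positionsP j (y : 'I_n) : (j < n %/ d)%N ->
  reflect (exists2 a, (a <= d)%N & y = ((j * d + a) %% n)%N :> nat)
          (y \in block_positions n d j).
Proof.
move=> jn; rewrite inE; apply: (iffP orP) => [[/eqP yj|/eqP ->]|[a]].
- exists (y %% d)%N; first by rewrite ltnW // ltn_pmod.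
  by rewrite -yj -divn_eq modn_small.
- by exists d => //; rewrite mulSnr.
rewrite leq_eqVlt => /orP[/eqP->|ad] ->.
  by right; rewrite mulSnr.
by left; rewrite modn_small ?lt_block // divnMDl // divn_small // addn0.
Qed.

(** Both sides are the images under [s] of the positions i + a modulo [n] for [a] from 0 to [d]. *)
Lemma cyclic_interval_block (i : 'I_n) : (d %| i)%N ->
  cyclic_interval v d.+1 i = cycle_edge d s (i %/ d).
Proof.
move=> di; have n_gt0 : (0 < n)%N by apply: leq_ltn_trans (ltn_ord i).
have id_lt : (i %/ d < n %/ d)%N by rewrite ltn_divLR // divnK.
have d_lt_n : (d < n)%N.
  by rewrite -[ltnRHS](divnK dvd_dn) ltn_Pmull // (leq_trans _ n_ge3d).
have nth_v a : (a < n)%N -> nth i (rot i v) a = s (Ordinal (ltn_pmod (i + a) n_gt0)).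
  move=> an; rewrite /rot nth_cat size_drop size_tuple nth_drop.
  have nth_s b (bn : (b < n)%N) : nth i v b = s (Ordinal bn).
    by rewrite -[b]/(val (Ordinal bn)) -tnth_nth tnth_mktuple.
  (* Position i + a either precedes the end of the list or wraps around, losing [n]. *)
  have [lt_an|le_na] := ltnP a (n - i).
    have lt_ian : (i + a < n)%N by lia.
    by rewrite (nth_s _ lt_ian); congr (s _); apply/val_inj; rewrite /= modn_small.
  have lt_ian : (a - (n - i) < i)%N by have := ltn_ord i; lia.
  rewrite nth_take // (nth_s _ (ltn_trans lt_ian (ltn_ord i))).
  congr (s _); apply/val_inj => /=.
  rewrite (_ : i + a = a - (n - i) + n)%N ?modnDr ?modn_small //; first lia.
  by have := ltn_ord i; lia.
have sz : size (take d.+1 (rot i v)) = d.+1.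
  by rewrite size_takel // size_rot size_tuple.
apply/setP => x; rewrite inE; apply/(nthP i)/imsetP => [[a]|[y]].
  rewrite sz ltnS => ad; rewrite nth_take // nth_v ?(leq_ltn_trans ad) // => <-.
  eexists; last reflexivity.
  by apply/block_positionsP => //; exists a => //=; rewrite divnK.
move/block_positionsP => /(_ id_lt)[a ad ya] ->; exists a; first by rewrite sz.
rewrite nth_take // nth_v ?(leq_ltn_trans ad) //.
by congr (s _); apply/val_inj; rewrite /= ya divnK.
Qed.

(** The common position is (j+1)d. With at least three blocks the far end of the next block stays
    outside block [j]; two blocks would share both ends. *)
Lemma card_consecutive_edges j : (j < n %/ d)%N ->
  #|cycle_edge d s j :&: cycle_edge d s (j.+1 %% (n %/ d))| = 1%N.
Proof.
have l_ge3 := n_ge3d; move: l_ge3; set l := (n %/ d)%N => l_ge3 jl.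
have l_gt0 : (0 < l)%N by apply: leq_trans l_ge3.
have nE : (l * d)%N = n by rewrite divnK.
have wrap b : (b * d %% n = b %% l * d)%N by rewrite -{1}nE -muln_modl.
have y0_lt : (j.+1 * d %% n < n)%N by rewrite ltn_pmod // -nE muln_gt0 l_gt0.
rewrite -imsetI; last by move=> ? ? _ _; apply: perm_inj.
rewrite card_imset; last exact: perm_inj.
rewrite -(cards1 (Ordinal y0_lt)); apply: eq_card => y; rewrite !inE -val_eqE /=.
rewrite !wrap; apply/andP/eqP => [[/orP[/eqP yj|/eqP //] /orP[/eqP|/eqP yE]]|->].
- rewrite yj; have [lt_Sj|le_lSj] := ltnP j.+1 l; first by rewrite modn_small //; lia.
  have -> : j.+1 = l by lia.
  by rewrite modnn; lia.
- move: yj; rewrite yE mulnK //.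
  have [lt_Sj|le_lSj] := ltnP j.+1 l.
    rewrite (modn_small lt_Sj).
    have [lt_SSj|le_lSSj] := ltnP j.+2 l; first by rewrite modn_small //; lia.
    have -> : j.+2 = l by lia.
    by rewrite modnn; lia.
  have -> : j.+1 = l by lia.
  by rewrite modnn modn_small; lia.
by rewrite mulnK // !eqxx orbT.
Qed.

Lemma cycle_edges_loose_hamilton (H : {set {set 'I_n}}) :
  cycle_edges d s \subset H -> has_loose_hamilton_cycle d.+1 H.
Proof.
move=> sH; apply/existsP; exists v; apply/existsP.
pose A := [set i : 'I_n | (d %| i)%N]; exists A.
have edgeH (j : 'I_(n %/ d)) : cycle_edge d s j \in H.
  by apply: (subsetP sH); apply: imset_f.
have lt_div (i : 'I_n) : (i %/ d < n %/ d)%N by rewrite ltn_divLR // divnK.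
apply/and4P; split.
- by rewrite map_inj_uniq ?enum_uniq //; apply: perm_inj.
- apply/forallP => i; apply/implyP; rewrite inE => di.
  by rewrite cyclic_interval_block // (edgeH (Ordinal (lt_div i))).
(* As [enum A] is increasing, the edges come in the order of the blocks 0, 1, ..., n/d - 1. *)
- have -> : [seq cyclic_interval v d.+1 i | i <- enum A] =
            [seq cycle_edge d s j | j <- iota 0 (n %/ d)].
    transitivity [seq cycle_edge d s (i %/ d) | i <- map val (enum A)].
      rewrite -map_comp; apply/eq_in_map => i; rewrite mem_enum inE => di.
      by rewrite /= cyclic_interval_block.
    have -> : map val (enum A) = [seq i <- iota 0 (n %/ d * d) | d %| i]%N.
      rewrite divnK // -val_enum_ord filter_map; congr (map _ _).
      by rewrite enumT; apply: eq_filter => i; rewrite /= inE.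
    rewrite filter_dvdn_iota // -map_comp.
    by apply: eq_map => j /=; rewrite mulnK.
  rewrite cycle_map; apply: cycle_iota => j jl.
  by rewrite /= card_consecutive_edges.
apply/forallP => x; apply/existsP.
pose y := (s^-1)%g x.
have y_lt : (y %/ d * d < n)%N by apply: leq_ltn_trans (leq_divM y d) _.
exists (Ordinal y_lt); rewrite inE /= dvdn_mull //=.
rewrite cyclic_interval_block /= ?dvdn_mull // mulnK //.
by rewrite -(permKV s x) imset_f // block_positions_divn.
Qed.

End LooseCycle.

Local Open Scope ring_scope.

(** * Random subsets and spread families *)

Section RandomSubset.
Variables (R : realFieldType) (X : finType).
Implicit Types (q : X -> R) (W Z T : {set X}) (Q : pred {set X}).

(** The density varies with the element, so that sets which are not possible edges can receive
    density 0. *)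
Definition subset_weight q W : R :=
  \prod_x (if x \in W then q x else 1 - q x).

Definition subset_Pr q Q : R := \sum_(W | Q W) subset_weight q W.

Lemma subset_weight_ge0 q W :
  (forall x, 0 <= q x <= 1) -> 0 <= subset_weight q W.
Proof.
move=> q01; apply: prodr_ge0 => x _.
by case: ifP => _; have /andP[q0 q1] := q01 x; rewrite ?subr_ge0.
Qed.

Lemma sum_subset_weight q : \sum_W subset_weight q W = 1.
Proof.
rewrite -bigA_distr.
by rewrite big1 // => x _; apply: subrKC.
Qed.

Lemma subset_Pr_le1 q Q : (forall x, 0 <= q x <= 1) -> subset_Pr q Q <= 1.
Proof.
move=> q01; rewrite -(sum_subset_weight q) /subset_Pr big_mkcond ler_sum // => W _.
by case: ifP => // _; rewrite subset_weight_ge0.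
Qed.

(* The union of independent random subsets of densities [q1] and [q2]. *)
Lemma subset_weight_setU q1 q2 Z :
  \sum_W1 \sum_(W2 | W1 :|: W2 == Z) subset_weight q1 W1 * subset_weight q2 W2 =
  subset_weight (fun x => 1 - (1 - q1 x) * (1 - q2 x)) Z.
Proof.
pose w (q : X -> R) x (b : bool) := if b then q x else 1 - q x.
(* The joint weight of the two choices at [x], set to 0 when they disagree with [Z]; expanding the
   product over [x] twice then leaves only the pairs with union [Z]. *)
pose h x b1 b2 : R :=
  if (b1 || b2) == (x \in Z) then w q1 x b1 * w q2 x b2 else 0.
transitivity (\prod_x ((h x true true + h x true false) +
                       (h x false true + h x false false))); last first.
  apply: eq_bigr => x _; rewrite /h /w /=.
  by case: (x \in Z) => /=; ring.
rewrite bigA_distr; apply: eq_bigr => W1 _.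
transitivity (\prod_x (h x (x \in W1) true + h x (x \in W1) false)); last first.
  by apply: eq_bigr => x _; case: (x \in W1).
rewrite bigA_distr big_mkcond; apply: eq_bigr => W2 _.
transitivity (\prod_x (h x (x \in W1) (x \in W2))); last first.
  by apply: eq_bigr => x _; case: (x \in W2).
case: eqP => [ZE|neqZ].
  rewrite -big_split /=; apply: eq_bigr => x _.
  by rewrite /h -ZE inE eqxx.
case: (pickP [pred x | ((x \in W1) || (x \in W2)) != (x \in Z)]) => [x /= xN|eqZ].
  by rewrite (bigD1 x) //= {1}/h (negbTE xN) mul0r.
by case: neqZ; apply/setP=> x; have /negbFE/eqP := eqZ x; rewrite inE.
Qed.

Lemma subset_Pr_setU q1 q2 Q :
  subset_Pr (fun x => 1 - (1 - q1 x) * (1 - q2 x)) Q =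
  \sum_W subset_weight q1 W * subset_Pr q2 (fun W' => Q (W :|: W')).
Proof.
rewrite /subset_Pr.
under eq_bigr => Z _ do rewrite -subset_weight_setU.
rewrite exchange_big; apply: eq_bigr => W1 _ /=.
rewrite big_distrr /= [RHS](partition_big (fun W2 => W1 :|: W2) Q) //=.
apply: eq_bigr => Z QZ; apply: eq_bigl => W2.
by apply/idP/andP => [/eqP ZE|[]//]; rewrite ZE.
Qed.

(** Coupling: adding an independent random set of density [d] to one of density [q1] yields density
    [q2], and an increasing event survives the addition. *)
Lemma le_subset_Pr q1 q2 Q :
    (forall x, 0 <= q1 x <= q2 x) -> (forall x, q2 x <= 1) ->
    (forall W W', W \subset W' -> Q W -> Q W') ->
  subset_Pr q1 Q <= subset_Pr q2 Q.
Proof.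
move=> q12 q2_le1 Qmono.
have q1_01 x : 0 <= q1 x <= 1.
  by have /andP[-> /le_trans ->] := q12 x.
(* Solves 1 - (1 - q1)(1 - d) = q2. Where [q1] is 1 the division by zero returns 0, which still
   fits, as [q2] is then 1. *)
pose d x := (q2 x - q1 x) / (1 - q1 x).
have d01 x : 0 <= d x <= 1.
  have /andP[q1_ge0 q1_le2] := q12 x.
  have [q1E|q1N1] := eqVneq (q1 x) 1; first by rewrite /d q1E subrr invr0 mulr0 lexx ler01.
  have q1_lt1 : 0 < 1 - q1 x.
    by rewrite subr_gt0 lt_neqAle q1N1; have /andP[] := q1_01 x.
  by rewrite /d divr_ge0 ?(ltW q1_lt1) ?subr_ge0 //= ler_pdivrMr // mul1r lerD2r.
have q2E : q2 =1 (fun x => 1 - (1 - q1 x) * (1 - d x)).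
  move=> x; have [q1E|q1N1] := eqVneq (q1 x) 1.
    rewrite q1E subrr mul0r subr0; apply/eqP; rewrite eq_le q2_le1 -q1E.
    by have /andP[] := q12 x.
  have q1_neq : 1 - q1 x != 0 by rewrite subr_eq0 eq_sym.
  by rewrite /d; field.
have -> : subset_Pr q2 Q = subset_Pr (fun x => 1 - (1 - q1 x) * (1 - d x)) Q.
  by apply: eq_bigr => W _; apply: eq_bigr => x _; rewrite -q2E.
rewrite subset_Pr_setU /subset_Pr big_mkcond; apply: ler_sum => W _.
have wge0 : 0 <= subset_weight q1 W by exact: subset_weight_ge0.
have Prge0 : 0 <= subset_Pr d (fun W' => Q (W :|: W')).
  by apply: sumr_ge0 => W' _; apply: subset_weight_ge0.
case: ifP => QW; last exact: mulr_ge0.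
rewrite ler_peMr // -(sum_subset_weight d) /subset_Pr [leRHS]big_mkcond.
apply: ler_sum => W' _; rewrite ifT //.
by apply: Qmono QW; apply: subsetUl.
Qed.

End RandomSubset.

(** * Fragments and the rounds of exposure for spread families *)

Section Spread.
Variables (R : realFieldType) (X J : finType) (q : X -> R) (p kappa N : R).
Hypotheses (q01 : forall x, 0 <= q x <= 1) (p_gt0 : 0 < p).
Hypotheses (kappa_ge0 : 0 <= kappa) (N_gt0 : 0 < N).
Implicit Types (W Z T : {set X}) (I : {set J}) (F : J -> {set X}).

(* [N] remains the size of the initial family while [I] shrinks from round to round. *)
Definition spread_family I F :=
  (forall i x, i \in I -> x \in F i -> q x = p) /\
  (forall T, #|[set i in I | T \subset F i]|%:R <= kappa ^+ #|T| * N).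

Definition fragment_index I F W i : J :=
  [arg min_(j < i | (j \in I) && (F j \subset W :|: F i)) #|F j :\: W|].

Definition fragment I F W i : {set X} := F (fragment_index I F W i) :\: W.

Lemma fragment_indexP I F W i : i \in I ->
  [/\ fragment_index I F W i \in I,
      F (fragment_index I F W i) \subset W :|: F i &
      forall j, j \in I -> F j \subset W :|: F i ->
        (#|fragment I F W i| <= #|F j :\: W|)%N].
Proof.
move=> iI; rewrite /fragment /fragment_index; case: arg_minnP => [|j /andP[jI jS] jmin].
  by rewrite iI subsetUr.
by split=> // j' j'I j'S; apply: jmin; rewrite j'I.
Qed.

Lemma fragment_subset I F W i : i \in I -> fragment I F W i \subset F i.
Proof.
move=> /fragment_indexP-/(_ F W)[_ jS _].
by rewrite /fragment subDset.
Qed.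

(** The choice depends on [Z] alone, so a fragment can be counted once [Z] is known. *)
Definition chosen_edge I F Z : {set X} :=
  if [pick j in I | F j \subset Z] is Some j then F j else set0.

(* Minimality forces the fragment [T] of [i] inside every edge contained in
   [W :|: T], so [T] is one of few subsets of an edge depending on [W :|: T] only. *)
Lemma fragment_subset_chosen_edge I F W i : i \in I ->
  fragment I F W i \subset chosen_edge I F (W :|: fragment I F W i).
Proof.
move=> iI; have [jI jS jmin] := fragment_indexP F W iI.
set T := fragment I F W i.
have TF : T \subset F i by apply: fragment_subset.
rewrite /chosen_edge; case: pickP => [j' /andP[j'I j'S]|/(_ (fragment_index I F W i))].
  have j'T : F j' :\: W \subset T by rewrite subDset.
  have /eqP <- : F j' :\: W == T.
    rewrite eqEcard j'T /=; apply: jmin => //.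
    by apply: subset_trans j'S _; apply: setUS.
  exact: subsetDl.
by rewrite jI /= /T /fragment -subDset subxx.
Qed.

(** Putting an element of [T] back replaces its factor 1 - p, which is at most 1, by p. *)
Lemma weight_setD Z T : (forall x, x \in T -> q x = p) -> T \subset Z ->
  subset_weight q (Z :\: T) * p ^+ #|T| <= subset_weight q Z.
Proof.
move=> qT TZ; rewrite -prodr_const [X in _ * X]big_mkcond -big_split /=.
apply: ler_prod => x _; have /andP[q0 q1] := q01 x.
rewrite inE; case: (boolP (x \in T)) => xT /=.
  rewrite (subsetP TZ) // mulr_ge0 ?subr_ge0 ?(ltW p_gt0) //= qT //.
  by rewrite ler_piMl ?(ltW p_gt0) // -(qT x xT) gerBl.
by rewrite mulr1 lexx andbT; case: ifP => _; rewrite ?subr_ge0.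
Qed.

(** A pair (W, i) with fragment [T] is counted through Z = W ∪ T. Passing from [W] to [Z] costs
    p^-|T|, spread allows at most kappa^|T| N indices [i], and [T] is one of at most 2^r subsets of
    the chosen edge. *)
Lemma sum_large_fragments I F r : spread_family I F ->
    (forall i, i \in I -> (#|F i| <= r)%N) -> kappa <= p ->
  \sum_W subset_weight q W *
     #|[set i in I | (r./2 < #|fragment I F W i|)%N]|%:R
  <= N * (4 * kappa / p) ^+ r./2.+1.
Proof.
move=> [qF spreadF] Fr kp; set s := r./2.
pose bad W i := (i \in I) && (s < #|fragment I F W i|)%N.
apply: (@le_trans _ _ (\sum_(u : {set X} * J | bad u.1 u.2) subset_weight q u.1)).
  rewrite -(pair_big_dep xpredT bad (fun W _ => subset_weight q W)) /=.
  rewrite le_eqVlt; apply/orP; left; apply/eqP; apply: eq_bigr => W _.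
  rewrite sumr_const mulr_natr; congr (_ *+ _).
  by apply: eq_card => i; rewrite !inE.
(* This encoding is injective because the fragment is disjoint from [W], so that [W] is recovered as
   Z minus T. *)
pose h (u : {set X} * J) := (u.1 :|: fragment I F u.1 u.2, fragment I F u.1 u.2, u.2).
pose g (v : {set X} * {set X} * J) := (v.1.1 :\: v.1.2, v.2).
have hK : cancel h g.
  move=> [W i]; rewrite /h /g /=; congr (_, _).
  rewrite setDUl setDv setU0; apply/setDidPl.
  by rewrite disjoint_sym /fragment disjoints_subset subsetDr.
pose ok (v : {set X} * {set X}) := (v.2 \subset chosen_edge I F v.1) && (s < #|v.2|)%N.
pose good (v : {set X} * {set X} * J) := ok v.1 && ((v.2 \in I) && (v.1.2 \subset F v.2)).
apply: (@le_trans _ _ (\sum_(v | good v) subset_weight q (v.1.1 :\: v.1.2))).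
  under eq_bigr => u _ do rewrite -{1}(hK u) /=.
  rewrite -(big_imset (h := h) (fun v => subset_weight q (v.1.1 :\: v.1.2)));
    last by move=> ? ? _ _; apply: (can_inj hK).
  rewrite /= big_mkcond [leRHS]big_mkcond; apply: ler_sum => v _.
  case: ifP => [/imsetP[[W i] /andP[/= iI sT] ->]|_].
    by rewrite /good /ok /= fragment_subset_chosen_edge // sT iI fragment_subset.
  by case: ifP => // _; apply: subset_weight_ge0.
rewrite -(pair_big_dep ok (fun v i => (i \in I) && (v.2 \subset F i))
                       (fun v _ => subset_weight q (v.1 :\: v.2))) /=.
have kp1 : kappa / p <= 1 by rewrite ler_pdivrMr // mul1r.
have kp0 : 0 <= kappa / p by rewrite divr_ge0 // ltW.
pose C := N * (kappa / p) ^+ s.+1.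
have C0 : 0 <= C by rewrite mulr_ge0 ?exprn_ge0 // ltW.
apply: (@le_trans _ _ (\sum_(v | ok v) subset_weight q v.1 * C)).
  apply: ler_sum => -[Z T] /andP[/= TS sT].
  have qT x : x \in T -> q x = p.
    move=> xT; move/subsetP/(_ x xT): TS; rewrite /chosen_edge.
    by case: pickP => [j /andP[jI _] /(qF j x jI)|_]; rewrite ?inE.
  have TZ : T \subset Z.
    apply: subset_trans TS _; rewrite /chosen_edge.
    by case: pickP => [j /andP[_ jZ]|_] //; apply: sub0set.
  rewrite sumr_const -mulr_natr.
  have -> : #|[pred i | (i \in I) && (T \subset F i)]| = #|[set i in I | T \subset F i]|.
    by apply: eq_card => i; rewrite !inE.
  have wZT0 : 0 <= subset_weight q (Z :\: T) by apply: subset_weight_ge0.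
  apply: le_trans (ler_wpM2l wZT0 (spreadF T)) _.
  have -> : kappa ^+ #|T| * N = p ^+ #|T| * (N * (kappa / p) ^+ #|T|).
    by rewrite mulrCA [RHS]mulrC -exprMn [p * _]mulrC divfK ?gt_eqF // mulrC.
  rewrite [leLHS]mulrA; apply: ler_pM; rewrite ?mulr_ge0 ?exprn_ge0 ?(ltW p_gt0) ?(ltW N_gt0) //.
    exact: weight_setD.
  by rewrite ler_pM2l // ler_wiXn2l.
rewrite -(pair_big_dep xpredT (fun Z T => ok (Z, T)) (fun Z _ => subset_weight q Z * C)) /=.
apply: (@le_trans _ _ (\sum_Z subset_weight q Z * (C * 4 ^+ s.+1))); last first.
  rewrite -mulr_suml sum_subset_weight mul1r /C -mulrA -exprMn.
  by rewrite [_ / p * 4]mulrC mulrA.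
apply: ler_sum => Z _; rewrite sumr_const -[leLHS]mulr_natr -[leLHS]mulrA.
apply: ler_wpM2l; first exact: subset_weight_ge0.
apply: ler_wpM2l => //; rewrite (_ : 4 = (2 ^ 2)%:R) // -natrX -expnM ler_nat.
apply: leq_trans (_ : 2 ^ #|chosen_edge I F Z| <= _)%N.
  rewrite -card_powerset; apply: subset_leq_card; apply/subsetP => T.
  by rewrite !inE /ok => /andP[].
(* As r is at most 2(s+1), the factor 2^r is absorbed by 4^(s+1). *)
rewrite leq_exp2l //; apply: leq_trans (_ : r <= _)%N.
  rewrite /chosen_edge; case: pickP => [j /andP[/Fr//]|_].
  by rewrite cards0.
by rewrite -[X in (X <= _)%N](odd_double_half r) -/s; case: odd; lia.
Qed.

(** If a member is left, it is empty and the event is certain; spread at the empty set gives |I| at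
    most [N]. *)
Lemma le_subset_Pr_empty (q' : X -> R) I F : spread_family I F ->
    (forall i, i \in I -> (#|F i| <= 0)%N) -> (forall x, 0 <= q' x <= 1) ->
  #|I|%:R / N - \sum_(1 <= j < 1) (4 * kappa / p) ^+ j <=
  subset_Pr q' (fun W => [exists i in I, F i \subset W]).
Proof.
move=> [_ spreadF] F0 q'01; rewrite big_geq // subr0.
have [->|[i iI]] := set_0Vmem I.
  by rewrite cards0 mul0r; apply: sumr_ge0 => W _; apply: subset_weight_ge0.
have -> : subset_Pr q' (fun W => [exists i in I, F i \subset W]) = 1.
  rewrite -(sum_subset_weight q'); apply: eq_bigl => W; apply/existsP; exists i.
  by rewrite iI; have := F0 i iI; rewrite leqn0 cards_eq0 => /eqP->; apply: sub0set.
have := spreadF set0; rewrite cards0 expr0 mul1r ler_pdivrMr // mul1r.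
by apply: le_trans; rewrite ler_nat; apply: subset_leq_card; apply/subsetP=> j jI; rewrite inE jI sub0set.
Qed.

(** Induction on the [m] independent rounds. Each round halves the size bound, and its expected loss
    is a single power of 4 kappa / p; the exponents differ from round to round, so a partial
    geometric series bounds the total. *)
Lemma le_subset_Pr_spread m : forall I F r, spread_family I F ->
    (forall i, i \in I -> (#|F i| <= r)%N) -> (r < 2 ^ m)%N -> kappa <= p ->
  #|I|%:R / N - \sum_(1 <= j < r.+1) (4 * kappa / p) ^+ j <=
  subset_Pr (fun x => 1 - (1 - q x) ^+ m)
    (fun W => [exists i in I, F i \subset W]).
Proof.
have qm01 n y : 0 <= 1 - (1 - q y) ^+ n <= 1.
  have /andP[q0 q1] := q01 y; rewrite subr_ge0 gerBl.
  by rewrite exprn_ile1 ?exprn_ge0 ?subr_ge0 // gerBl.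
elim: m => [|m IHm] I F [|r] spreadF Fr rm kp //.
- exact: le_subset_Pr_empty spreadF Fr (qm01 0%N).
- exact: le_subset_Pr_empty spreadF Fr (qm01 m.+1).
set s := r.+1./2.
pose qm x := 1 - (1 - q x) ^+ m.
pose I' W := [set i in I | (#|fragment I F W i| <= s)%N].
pose bad W := [set i in I | (s < #|fragment I F W i|)%N].
have I'E W : #|I' W|%:R = #|I|%:R - #|bad W|%:R :> R.
  have <- : (#|I' W| + #|bad W|)%N = #|I|.
    rewrite -(cardsID [set i | (#|fragment I F W i| <= s)%N] I); congr (_ + _)%N.
      by apply: eq_card => i; rewrite !inE.
    by apply: eq_card => i; rewrite !inE ltnNge andbC.
  by rewrite natrD addrK.
have sm : (s < 2 ^ m)%N by move: rm; rewrite expnS /s; lia.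
set x := 4 * kappa / p in IHm *.
have x0 : 0 <= x by rewrite /x divr_ge0 ?mulr_ge0 // ltW.
(* The small fragments are spread with the same [kappa] and [N], being subsets of the members they
   come from; covering one of them by [W'] puts a whole member inside W ∪ W'. *)
have IH W : #|I' W|%:R / N - \sum_(1 <= j < s.+1) x ^+ j <=
    subset_Pr qm (fun W' => [exists i in I, F i \subset W :|: W']).
  apply: le_trans (_ : subset_Pr qm
    (fun W' => [exists i in I' W, fragment I F W i \subset W']) <= _).
    apply: IHm => //; last by move=> i; rewrite inE => /andP[].
    case: spreadF => qF spreadF; split=> [i y|T].
      rewrite inE => /andP[iI _] /(subsetP (fragment_subset F W iI)).
      exact: qF.
    apply: le_trans (spreadF T); rewrite ler_nat; apply: subset_leq_card.
    apply/subsetP => i; rewrite !inE => /andP[/andP[iI _] Ti].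
    by rewrite iI (subset_trans Ti) // fragment_subset.
  rewrite /subset_Pr big_mkcond [leRHS]big_mkcond; apply: ler_sum => W' _.
  case: ifP => [/existsP[i /andP[]]|_].
    rewrite inE /fragment => /andP[iI _] iW'; rewrite ifT //.
    apply/existsP; exists (fragment_index I F W i).
    by have [-> _ _] := fragment_indexP F W iI; rewrite -subDset.
  by case: ifP => // _; exact: subset_weight_ge0 (qm01 m).
have -> : subset_Pr (fun y => 1 - (1 - q y) ^+ m.+1)
    (fun W => [exists i in I, F i \subset W]) =
    subset_Pr (fun y => 1 - (1 - q y) * (1 - qm y))
    (fun W => [exists i in I, F i \subset W]).
  apply: eq_bigr => W _; apply: eq_bigr => y _.
  by rewrite /qm !subKr exprS.
rewrite subset_Pr_setU.
apply: le_trans (_ : \sum_W subset_weight q W *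
    (#|I' W|%:R / N - \sum_(1 <= j < s.+1) x ^+ j) <= _); last first.
  by apply: ler_sum => W _; apply: ler_wpM2l; rewrite ?subset_weight_ge0.
have -> : \sum_W subset_weight q W *
    (#|I' W|%:R / N - \sum_(1 <= j < s.+1) x ^+ j) =
    (#|I|%:R / N - \sum_(1 <= j < s.+1) x ^+ j) -
    (\sum_W subset_weight q W * #|bad W|%:R) / N.
  set c := (Y in Y - _).
  have -> : c = \sum_W subset_weight q W * c.
    by rewrite -mulr_suml sum_subset_weight mul1r.
  by rewrite mulr_suml -sumrB; apply: eq_bigr => W _; rewrite I'E /c; ring.
(* The expected loss, divided by [N], is at most x^(s+1): a new term of the series, still in range
   because s + 1 is at most r + 1. *)
have badS := sum_large_fragments spreadF Fr kp.
rewrite -addrA -opprD lerD2l lerN2.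
apply: le_trans (_ : \sum_(1 <= j < s.+1) x ^+ j + x ^+ s.+1 <= _).
  by rewrite lerD2l ler_pdivrMr // mulrC.
rewrite -big_nat_recr //= (@big_cat_nat _ _ _ s.+2 _ r.+2) //=; last by rewrite /s; lia.
by rewrite lerDl sumr_ge0 // => j _; rewrite exprn_ge0.
Qed.

End Spread.

(** * The random hypergraph *)

Lemma card_cycle_edge n d (s : {perm 'I_n}) j : (0 < d)%N -> (d %| n)%N ->
  (3 <= n %/ d)%N -> (j < n %/ d)%N -> #|cycle_edge d s j| = d.+1.
Proof.
move=> d_gt0 dvd_dn l_ge3 jn; rewrite card_imset; last exact: perm_inj.
have d_lt_n : (d < n)%N.
  by rewrite -[ltnRHS](divnK dvd_dn) ltn_Pmull // (leq_trans _ l_ge3).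
have n_gt0 : (0 < n)%N by apply: leq_trans d_lt_n.
pose f (a : 'I_d.+1) := Ordinal (ltn_pmod (j * d + a) n_gt0).
rewrite -[RHS]card_ord -[RHS](card_codom (f := f)); last first.
  move=> a b /(congr1 val) /= /eqP; rewrite eqn_modDl.
  rewrite !modn_small ?(leq_trans (ltn_ord _)) // => /eqP ab.
  exact: val_inj.
apply: eq_card => y; apply/(block_positionsP d_gt0 dvd_dn)/codomP => // [[a ad ya]|[a ->]].
  by exists (Ordinal (ad : (a < d.+1)%N)); apply/val_inj.
by exists a => //; rewrite -ltnS.
Qed.

(** Used to see that [m] rounds of density p/m expose each edge with probability at most p. *)
Lemma bernoulli_le (R : realFieldType) (y : R) m : 0 <= y <= 1 ->
  1 - y *+ m <= (1 - y) ^+ m.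
Proof.
move=> /andP[y0 y1]; elim: m => [|m IHm]; first by rewrite mulr0n subr0.
have : (1 - y) * (1 - y *+ m) <= (1 - y) ^+ m.+1.
  by rewrite exprS ler_wpM2l ?subr_ge0.
apply: le_trans; rewrite mulrS.
have : 0 <= y * (y *+ m) by rewrite mulr_ge0 ?mulrn_wge0.
lra.
Qed.

Lemma sum_geometric_le (R : realFieldType) (x : R) m : 0 <= x <= 2^-1 ->
  \sum_(1 <= j < m.+1) x ^+ j <= 2 * x.
Proof.
move=> /andP[x0 x1].
(* The subtracted remainder makes the induction close, since doubling x^(m+2) gives at most
   x^(m+1). *)
suff : \sum_(1 <= j < m.+1) x ^+ j <= 2 * x - 2 * x ^+ m.+1.
  by move/le_trans; apply; rewrite gerBl mulr_ge0 ?exprn_ge0.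
elim: m => [|m IHm]; first by rewrite big_geq // expr1 subrr.
rewrite big_nat_recr //=; have xm : 0 <= x ^+ m.+1 by rewrite exprn_ge0.
have : x * x ^+ m.+1 <= 2^-1 * x ^+ m.+1 by rewrite ler_wpM2r.
rewrite (exprS x m.+1); lra.
Qed.

(** A family containing a set that is not a k-subset has a factor 0 in its weight. *)
Lemma hypergraph_PrE (R : realFieldType) n k (p : R) (Q : pred {set {set 'I_n}}) :
  hypergraph_Pr k p Q =
  subset_Pr (fun e => if e \in ksubsets n k then p else 0) Q.
Proof.
rewrite /subset_Pr [RHS](bigID (fun H : {set {set 'I_n}} => H \subset ksubsets n k)) /=.
rewrite [X in _ + X]big1 ?addr0 => [|H /andP[_ /subsetPn[e eH eG]]]; last first.
  by rewrite /subset_weight (bigD1 e) //= eH (negbTE eG) mul0r.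
apply: eq_big => [H|H /andP[HG _]]; first by rewrite andbC.
rewrite /hypergraph_weight big_mkcond; apply: eq_bigr => e _.
case: (boolP (e \in ksubsets n k)) => // eG.
by rewrite subr0; case: ifP => // /(subsetP HG); rewrite (negbTE eG).
Qed.

(** The spread family consists of the edge sets of the cycles of all n! permutations, with kappa =
    2^((d+1)(d+2)) c^d. The number [c] stands for e/n; its hypothesis turns (n - t)!/n! into a
    power. *)
Lemma loose_hamilton_lower_bound (R : realFieldType) n d m (p c x : R) :
    (0 < d)%N -> (d %| n)%N -> (3 <= n %/ d)%N -> (n %/ d < 2 ^ m)%N ->
    0 < p <= 1 -> 0 <= c ->
    (forall t, (t <= n)%N -> (n - t)`!%:R <= c ^+ t * n`!%:R) ->
      x = 4 * (2 ^+ (d.+1 * d.+2) * c ^+ d) * m%:R / p -> x <= 2^-1 ->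
  1 - 2 * x <= hypergraph_Pr d.+1 p (@has_loose_hamilton_cycle n d.+1).
Proof.
move=> d_gt0 dvd_dn l_ge3 lm /andP[p_gt0 p_le1] c_ge0 c_fact.
have n_gt0 : (0 < n)%N by case: (posnP n) l_ge3 => // ->; rewrite div0n.
have m_gt0 : (0 < m)%N by case: m lm => //; rewrite expn0 ltnS; case: (n %/ d)%N l_ge3.
have mR : 0 < m%:R :> R by rewrite ltr0n.
set kappa := 2 ^+ (d.+1 * d.+2) * c ^+ d => x_def x_le.
have kappa_ge0 : 0 <= kappa by rewrite mulr_ge0 ?exprn_ge0.
(* The density of one round out of [m]. *)
pose p0 := p / m%:R; pose q0 e := if e \in ksubsets n d.+1 then p0 else 0.
have p0_gt0 : 0 < p0 by rewrite divr_gt0.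
have p0_le1 : p0 <= 1.
  by rewrite ler_pdivrMr // mul1r (le_trans p_le1) // ler1n.
have q01 e : 0 <= q0 e <= 1.
  by rewrite /q0; case: ifP => _; rewrite ?lexx ?ler01 ?(ltW p0_gt0).
have xE : x = 4 * kappa / p0 by rewrite x_def /p0 invf_div [RHS]mulrA.
have x_ge0 : 0 <= x.
  by rewrite xE divr_ge0 ?(ltW p0_gt0) //; apply: mulr_ge0; rewrite ?ler0n.
have kp : kappa <= p0.
  have : 4 * kappa <= 2^-1 * p0 by rewrite -ler_pdivrMr // -xE.
  by move: kappa_ge0 p0_gt0; lra.
pose I := [set: {perm 'I_n}].
have nf : 0 < n`!%:R :> R by rewrite ltr0n fact_gt0.
have spreadI : spread_family q0 p0 kappa n`!%:R I (@cycle_edges n d).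
  split=> [s e _ /imsetP[j _ ->]|T].
    by rewrite /q0 inE card_cycle_edge // eqxx.
  have -> : [set s in I | T \subset cycle_edges d s] = [set s | T \subset cycle_edges d s].
    by apply/setP => s; rewrite !inE.
  have [->|[s0]] := set_0Vmem [set s | T \subset cycle_edges d s].
    by rewrite cards0 mulr_ge0 ?exprn_ge0 // ltW.
  rewrite inE => /subset_leq_card Ts.
  have Tn : (#|T| * d <= n)%N.
    rewrite -leq_divRL //; apply: leq_trans Ts _.
    by apply: leq_trans (leq_imset_card _ _) _; rewrite card_ord.
  have := card_spread_perms d_gt0 dvd_dn T n_gt0.
  rewrite -(ler_nat R) => /le_trans; apply.
  rewrite natrM natrX exprMn -!exprM mulnC [(d * _)%N]mulnC -mulrA.
  by rewrite ler_wpM2l ?exprn_ge0 ?c_fact.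
have sizeF s : s \in I -> (#|cycle_edges d s| <= n %/ d)%N.
  by move=> _; apply: leq_trans (leq_imset_card _ _) _; rewrite card_ord.
have := le_subset_Pr_spread q01 p0_gt0 kappa_ge0 nf spreadI sizeF lm kp.
rewrite cardsT card_Sn divff ?gt_eqF // -xE.
move=> lower; apply: le_trans (le_trans lower _).
  by rewrite lerD2l lerN2 sum_geometric_le // x_ge0.
pose q e : R := if e \in ksubsets n d.+1 then p else 0.
rewrite hypergraph_PrE -/q.
(* The [m] rounds together have density at most [p], so monotonicity passes the bound on to the
   hypergraph. *)
have q0m e : 0 <= 1 - (1 - q0 e) ^+ m <= q e.
  have /andP[q0_ge0 q0_le1] := q01 e.
  rewrite subr_ge0 exprn_ile1 ?subr_ge0 ?gerBl //=.
  apply: (@le_trans _ _ (q0 e *+ m)).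
    by rewrite lerBlDr addrC -lerBlDr bernoulli_le // q0_ge0.
  rewrite /q0 /q; case: ifP => _; last by rewrite mul0rn.
  by rewrite -mulr_natr divfK // gt_eqF.
have q_le1 e : q e <= 1 by rewrite /q; case: ifP.
apply: le_trans (le_subset_Pr q0m q_le1 _) _.
  move=> W W' WW' /existsP[s /andP[sI sW]]; apply/existsP; exists s.
  by rewrite sI (subset_trans sW).
rewrite /subset_Pr big_mkcond [leRHS]big_mkcond; apply: ler_sum => H _.
case: ifP => [/existsP[s /andP[_ sH]]|_].
  by rewrite (cycle_edges_loose_hamilton d_gt0 dvd_dn l_ge3 sH).
case: ifP => // _; apply: subset_weight_ge0 => e; rewrite q_le1 andbT.
by have /andP[/le_trans] := q0m e; apply.
Qed.

(* Estimates on factorials and logarithms, and the limit *)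
From mathcomp Require Import all_classical all_reals all_analysis.
Import numFieldNormedType.Exports.

Local Open Scope classical_set_scope.

(** Induction on [n]: for t at most n, (1 + 1/n)^t is at most e^(t/n), hence at most e. *)
Lemma expn_fact_le (R : realType) n t : (t <= n)%N ->
  n%:R ^+ t * (n - t)`!%:R <= expR 1 ^+ t * n`!%:R :> R.
Proof.
elim: n t => [|n IHn] [|t] //; rewrite ?expr0 ?mul1r ?subn0 // ltnS => tn.
have step : n.+1%:R ^+ t <= expR 1 * n%:R ^+ t :> R.
  case: n tn {IHn} => [|n] tn.
    by move: tn; rewrite leqn0 => /eqP->; rewrite !expr0 mulr1 -[leLHS]expR0 ler_expR.
  have n0 : n.+1%:R != 0 :> R by rewrite pnatr_eq0.
  have -> : n.+2%:R = (1 + n.+1%:R^-1) * n.+1%:R :> R.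
    by rewrite mulrDl mul1r mulVf // natr1.
  rewrite exprMn ler_wpM2r ?exprn_ge0 //.
  apply: (@le_trans _ _ (expR n.+1%:R^-1 ^+ t)).
    by rewrite lerXn2r ?nnegrE ?addr_ge0 ?expR_ge0 ?expR_ge1Dx.
  rewrite -expRM_natl ler_expR ler_pdivrMr ?ltr0n // mul1r ler_nat.
  exact: tn.
rewrite subSS factS natrM exprS -!mulrA.
have -> : expR 1 ^+ t.+1 * (n.+1%:R * n`!%:R) =
    n.+1%:R * (expR 1 * (expR 1 ^+ t * n`!%:R)) :> R by rewrite exprS; ring.
rewrite ler_wpM2l //; apply: le_trans (ler_wpM2r _ step) _ => //.
by rewrite -mulrA ler_wpM2l ?expR_ge0 // IHn.
Qed.

(** Bounds the number of rounds by a multiple of log n: the logarithm and the added 1 each cost at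
    most ln n / ln 2. *)
Lemma trunc_log_le_ln (R : realType) l n : (0 < l)%N -> (l <= n)%N -> (2 <= n)%N ->
  (trunc_log 2 l).+1%:R <= 2 / ln 2 * ln n%:R :> R.
Proof.
move=> l_gt0 ln_ n_ge2; have ln2 : 0 < ln 2 :> R by rewrite ln_gt0 ?ltr1n.
rewrite mulrAC ler_pdivlMr // -natr1 mulrDl mul1r mulr_natl.
rewrite (_ : 2 * ln n%:R = ln n%:R + ln n%:R); last by ring.
apply: lerD.
  rewrite -lnXn // -natrX ler_ln ?posrE ?ltr0n ?expn_gt0 ?(leq_trans _ n_ge2) //.
  by rewrite ler_nat (leq_trans _ ln_) // trunc_logP.
by rewrite ler_ln ?posrE ?ltr0n ?ler_nat // (leq_trans _ n_ge2).
Qed.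

Theorem theorem1p2 (R : realType) (k : nat) (hk : (3 <= k)%N) (p : nat -> R)
    (hp01 : forall n : nat, 0 <= p n <= 1)
    (hp : p n * n%:R ^+ (k - 1) / ln n%:R @[n --> \oo] --> +oo) :
  hypergraph_Pr k (p n) (@has_loose_hamilton_cycle n k)
    @[n --> within [set n : nat | (2 * (k - 1) %| n)%N] \oo] --> (1 : R).
Proof.
case: k hk hp => [//|d] hk; rewrite subn1 /= => hp.
have d_gt0 : (0 < d)%N by apply: ltnW.
(* Chosen so that, with at most (2 / ln 2) ln n rounds and c = e/n, the quantity [x] below is at
   most K ln n / (p n^d). *)
pose K : R := 4 * (2 ^+ (d.+1 * d.+2) * expR 1 ^+ d) * (2 / ln 2).
have ln2 : 0 < ln 2 :> R by rewrite ln_gt0 ?ltr1n.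
have K_gt0 : 0 < K.
  by rewrite /K mulr_gt0 ?divr_gt0 // mulr_gt0 // mulr_gt0 ?exprn_gt0 ?expR_gt0.
apply/cvgrPdist_le => eps eps_gt0; rewrite near_withinE.
(* Makes 2K/a equal to 1/(1 + 1/eps), which is at most both 1 and eps: hence [x] is at most 1/2 and
   the failure probability at most eps. *)
pose a := 2 * K * (1 + eps^-1).
have a_gt0 : 0 < a.
  by rewrite /a mulr_gt0 ?addr_gt0 ?invr_gt0 // mulr_gt0.
have ratio := (cvgryPge _).1 hp a.
near=> n => /= dvd_n.
have n_ge : (3 * d <= n)%N by near: n; apply: nbhs_infty_ge.
have n_ge2 : (2 <= n)%N by apply: leq_trans n_ge; lia.
have n_gt0 : (0 < n)%N by apply: ltnW.
have dvd_dn : (d %| n)%N by apply: dvdn_trans dvd_n; apply: dvdn_mull.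
have l_ge3 : (3 <= n %/ d)%N by rewrite leq_divRL.
have a_le : a <= p n * n%:R ^+ d / ln n%:R by near: n; exact: ratio.
have ln_n : 0 < ln n%:R :> R by rewrite ln_gt0 // ltr1n.
have nR : 0 < n%:R :> R by rewrite ltr0n.
have [p0 p1] := andP (hp01 n).
have p_gt0 : 0 < p n.
  rewrite lt_neqAle p0 andbT; apply/eqP => pn0.
  by move: (lt_le_trans a_gt0 a_le); rewrite -pn0 !mul0r ltxx.
pose m := (trunc_log 2 (n %/ d)).+1; pose c : R := expR 1 / n%:R.
pose x := 4 * (2 ^+ (d.+1 * d.+2) * c ^+ d) * m%:R / p n.
have pn_gt0 : 0 < p n * n%:R ^+ d by rewrite mulr_gt0 ?exprn_gt0.
have x_le : x <= K / a.
  have m_le : m%:R <= 2 / ln 2 * ln n%:R :> R.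
    by apply: trunc_log_le_ln; rewrite ?leq_div // (leq_trans _ l_ge3).
  have -> : x = 4 * (2 ^+ (d.+1 * d.+2) * expR 1 ^+ d) * m%:R / (p n * n%:R ^+ d).
    rewrite /x /c expr_div_n; field.
    by rewrite !gt_eqF ?exprn_gt0.
  rewrite ler_pdivrMr //; apply: (@le_trans _ _ (K * ln n%:R)).
    rewrite /K -[leRHS]mulrA ler_wpM2l // ?mulr_ge0 ?exprn_ge0 ?expR_ge0 //.
  rewrite -[leRHS]mulrA ler_wpM2l ?(ltW K_gt0) // mulrC ler_pdivlMr //.
  by rewrite mulrC -ler_pdivlMr.
have Ka : 2 * (K / a) = (1 + eps^-1)^-1.
  rewrite /a; field.
  by rewrite !gt_eqF ?addr_gt0 //.
have x2 : 2 * x <= (1 + eps^-1)^-1 by rewrite -Ka ler_wpM2l.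
have inv1 : (1 + eps^-1)^-1 <= 1.
  by rewrite invf_le1 ?lerDl ?addr_gt0 ?invr_ge0 ?invr_gt0 // ltW.
have inv2 : (1 + eps^-1)^-1 <= eps.
  rewrite -[leRHS]invrK lef_pV2 ?posrE ?addr_gt0 ?invr_gt0 // lerDr //.
have x_half : x <= 2^-1 by lra.
have lower := @loose_hamilton_lower_bound R n d m (p n) c x d_gt0 dvd_dn l_ge3.
have upper : hypergraph_Pr d.+1 (p n) (@has_loose_hamilton_cycle n d.+1) <= 1.
  rewrite hypergraph_PrE; apply: subset_Pr_le1 => e.
  by case: ifP => _; rewrite ?lexx ?ler01 ?p0 ?p1.
rewrite ger0_norm ?subr_ge0 // lerBlDr -lerBlDl.
apply: le_trans (lower _ _ _ _ erefl x_half).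
- by rewrite lerD2l lerN2; lra.
- exact: trunc_log_ltn.
- by rewrite p_gt0.
- by rewrite divr_ge0 ?expR_ge0.
move=> t tn; rewrite /c expr_div_n mulrAC ler_pdivlMr ?exprn_gt0 //.
by rewrite mulrC expn_fact_le.
Unshelve. all: by end_near.
Qed.
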